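(* For all integers $n\ge 1$ and $k\ge1$, $$H^k(fB_n,\mathbb{Q})\cong 0,$$ and for $n>k\ge1$, $$H^k(PfB_n,\mathbb{Q})^{S_n}\;\cong\;H^k(fB_n,\mathbb{Q})\;\cong\;0.$$
   Context: $vB_n$ (virtual braid group) is the group generated by $\sigma_1,\dots,\sigma_{n-1}$ and $s_1,\dots,s_{n-1}$ with relations: $\sigma_i\sigma_{i+1}\sigma_i=\sigma_{i+1}\sigma_i\sigma_{i+1}$; $\sigma_i\sigma_j=\sigma_j\sigma_i$ for $|i-j|>1$; $s_is_{i+1}s_i=s_{i+1}s_is_{i+1}$; $s_is_j=s_js_i$ for $|i-j|>1$; $s_i^2=1$; $s_i\sigma_{i+1}^{\pm1}s_i=s_{i+1}\sigma_i^{\pm1}s_{i+1}$; $s_i\sigma_j=\sigma_js_i$ for $|i-j|>1$. The flat braid group $fB_n$ is the quotient of $vB_n$ by the relations $\sigma_i^2=1$ for $i=1,\dots,n-1$. The pure flat braid group $PfB_n$ is the kernel of the surjection $fB_n\to S_n$ sending both $\sigma_i$ and $s_i$ to the transposition $(i\ i+1)$; it is presented by generators $R_{ij}$, $1\le i\ne j\le n$, with relations $R_{ij}R_{ik}R_{jk}=R_{jk}R_{ik}R_{ij}$, $R_{ij}R_{kl}=R_{kl}R_{ij}$ and $R_{ij}R_{ji}=1$ for distinct $i,j,k,l$. The group $S_n=fB_n/PfB_n$ acts on $H^k(PfB_n,\mathbb{Q})$; this action is induced by $\sigma\cdot R_{ij}=R_{\sigma(i)\sigma(j)}$. It is known that $H^*(PfB_n,\mathbb{Q})$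 is $S_n$-equivariantly isomorphic to the exterior algebra over $\mathbb{Q}$ on degree-1 generators $r_{ij}$, $1\le i\neq j\le n$, with $r_{ij}=-r_{ji}$, modulo the relations $r_{ij}\wedge r_{ik}=r_{ij}\wedge r_{jk}$ and $r_{ik}\wedge r_{jk}=r_{ij}\wedge r_{jk}$ for $i<j<k$, with $\sigma(r_{ij})=r_{\sigma(i)\sigma(j)}$. For a module $V$ over a group $G$, $V^G$ denotes the submodule of $G$-invariants. Cohomology is with trivial rational coefficients. *)

(* Defs.v *)
(* boolp provides quotients by non-decidable relations, functions the vector
   space structure on T -> V. *)
From HB Require Import structures.
From mathcomp Require Import all_boot all_algebra all_fingroup.
From mathcomp Require Import boolp functions.
From mathcomp Require Import zify.
Import generic_quotient ring_quotient.
Import GRing.Theory.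

Set Implicit Arguments.
Unset Strict Implicit.
Unset Printing Implicit Defensive.

Local Open Scope group_scope.
Local Open Scope quotient_scope.

(* The letter (x, false) is the generator x, the letter (x, true) its formal
   inverse. *)
Notation word X := (seq (X * bool)).

Definition linv (X : Type) (l : X * bool) : X * bool := (l.1, ~~ l.2).
Definition winv (X : Type) (w : word X) : word X := rev (map (@linv X) w).

Section PresentedGroup.
Variables (X : choiceType) (rel : word X -> word X -> Prop).

Inductive weq : word X -> word X -> Prop :=
| weq_rel u v : rel u v -> weq u v
| weq_cancel l : weq [:: l; linv l] [::]
| weq_refl u : weq u u
| weq_sym u v : weq u v -> weq v u
| weq_trans u v w : weq u v -> weq v w -> weq u w
| weq_cat u u' v v' : weq u u' -> weq v v' -> weq (u ++ v) (u' ++ v').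

Definition weqb (u v : word X) : bool := `[< weq u v >].

Lemma weqb_equiv : equiv_class_of weqb.
Proof.
split=> [u|u v|v u w]; first by apply/asboolP/weq_refl.
- by apply/asboolP/asboolP => /weq_sym.
- by move=> /asboolP uv /asboolP vw; apply/asboolP; apply: weq_trans uv vw.
Qed.

Canonical weqb_equiv_rel := EquivRelPack weqb_equiv.
Canonical weqb_encModRel := defaultEncModRel weqb.

Definition presented := {eq_quot weqb}.

HB.instance Definition _ : EqQuotient (word X) weqb presented :=
  EqQuotient.on presented.
HB.instance Definition _ := Choice.on presented.

Definition pres_class (w : word X) : presented := \pi_presented w.

Lemma pres_classP u v : pres_class u = pres_class v <-> weq u v.
Proof. by split=> [/eqmodP/asboolP|uv]; last exact/eqmodP/asboolP. Qed.

Lemma pres_reprK x : pres_class (repr x) = x.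
Proof. exact: reprK. Qed.

Lemma weq_repr w : weq (repr (pres_class w)) w.
Proof. by apply/pres_classP; rewrite pres_reprK. Qed.

Definition pres_one : presented := pres_class [::].
Definition pres_mul (x y : presented) : presented :=
  pres_class (repr x ++ repr y).
Definition pres_inv (x : presented) : presented := pres_class (winv (repr x)).

Lemma linvK : involutive (@linv X).
Proof. by case=> x b; rewrite /linv /= negbK. Qed.

Lemma winv_cat (u v : word X) : winv (u ++ v) = winv v ++ winv u.
Proof. by rewrite /winv map_cat rev_cat. Qed.

Lemma winvK : involutive (@winv X).
Proof.
move=> w; rewrite /winv map_rev revK -map_comp -[RHS]map_id.
by apply: eq_map => l /=; rewrite linvK.
Qed.

Lemma weq_mulwV (w : word X) : weq (w ++ winv w) [::].
Proof.
elim: w => [|l w IHw]; first exact: weq_refl.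
rewrite -cat1s winv_cat -catA (catA w).
apply: weq_trans (weq_cancel l).
rewrite -[[:: l; _]]/([:: l] ++ ([::] ++ winv [:: l])).
apply: weq_cat; first exact: weq_refl.
by apply: weq_cat; last exact: weq_refl.
Qed.

Lemma pres_mulE u v : pres_mul (pres_class u) (pres_class v) = pres_class (u ++ v).
Proof. by apply/pres_classP/weq_cat; apply: weq_repr. Qed.

Lemma pres_mulA : associative pres_mul.
Proof.
move=> x y z; rewrite -(pres_reprK x) -(pres_reprK y) -(pres_reprK z).
by rewrite !pres_mulE catA.
Qed.

Lemma pres_mul1g : left_id pres_one pres_mul.
Proof. by move=> x; rewrite -(pres_reprK x) pres_mulE. Qed.

Lemma pres_mulg1 : right_id pres_one pres_mul.
Proof. by move=> x; rewrite -(pres_reprK x) pres_mulE cats0. Qed.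

Lemma pres_mulgV : right_inverse pres_one pres_inv pres_mul.
Proof.
by move=> x; rewrite -{1}(pres_reprK x) pres_mulE; apply/pres_classP/weq_mulwV.
Qed.

Lemma pres_mulVg : left_inverse pres_one pres_inv pres_mul.
Proof.
move=> x; rewrite -{2}(pres_reprK x) pres_mulE; apply/pres_classP.
by rewrite -{2}(winvK (repr x)); apply: weq_mulwV.
Qed.

HB.instance Definition _ := isGroup.Build presented
  pres_mulA pres_mul1g pres_mulg1 pres_mulVg pres_mulgV.

Section Hom.
Variables (H : groupType) (f : X -> H).

Definition leval (l : X * bool) : H := if l.2 then (f l.1)^-1 else f l.1.
Definition weval (w : word X) : H := foldr (fun l h => leval l * h) 1 w.

Lemma weval_cat u v : weval (u ++ v) = weval u * weval v.
Proof. by elim: u => /= [|l u ->]; rewrite ?mul1g ?mulgA. Qed.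

Hypothesis f_rel : forall u v, rel u v -> weval u = weval v.

Lemma weq_weval u v : weq u v -> weval u = weval v.
Proof.
elim=> {u v} [u v /f_rel //|[x b]|//|u v _ -> //|u v w _ -> _ -> //|].
  by rewrite /= /leval /=; case: b; rewrite /= mulg1 ?mulVg ?mulgV.
by move=> u u' v v' _ uu' _ vv'; rewrite !weval_cat uu' vv'.
Qed.

Definition pres_hom (x : presented) : H := weval (repr x).

Lemma pres_homE w : pres_hom (pres_class w) = weval w.
Proof. exact/weq_weval/weq_repr. Qed.

Lemma pres_homM : {morph pres_hom : x y / x * y}.
Proof.
move=> x y; rewrite -[x]pres_reprK -[y]pres_reprK.
by rewrite [_ * _]pres_mulE !pres_homE weval_cat.
Qed.
End Hom.

End PresentedGroup.

(* Indices start at 0: for i : 'I_n.-1, the generators \sigma_(i+1) and s_(i+1)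
   of the usual presentation are inl i and inr i. *)
Definition vgen (n : nat) : choiceType := ('I_n.-1 + 'I_n.-1)%type.

Definition sg (n : nat) (i : 'I_n.-1) : word (vgen n) := [:: (inl i, false)].
Definition sgV (n : nat) (i : 'I_n.-1) : word (vgen n) := [:: (inl i, true)].
Definition sv (n : nat) (i : 'I_n.-1) : word (vgen n) := [:: (inr i, false)].

Definition far (n : nat) (i j : 'I_n.-1) : bool := (i.+1 < j) || (j.+1 < i).

Inductive vB_rel (n : nat) : word (vgen n) -> word (vgen n) -> Prop :=
| vB_sg_braid (i j : 'I_n.-1) : j = i.+1 :> nat ->
    vB_rel (sg i ++ sg j ++ sg i) (sg j ++ sg i ++ sg j)
| vB_sg_far (i j : 'I_n.-1) : far i j -> vB_rel (sg i ++ sg j) (sg j ++ sg i)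
| vB_sv_braid (i j : 'I_n.-1) : j = i.+1 :> nat ->
    vB_rel (sv i ++ sv j ++ sv i) (sv j ++ sv i ++ sv j)
| vB_sv_far (i j : 'I_n.-1) : far i j -> vB_rel (sv i ++ sv j) (sv j ++ sv i)
| vB_sv_sqr (i : 'I_n.-1) : vB_rel (sv i ++ sv i) [::]
| vB_mixed (i j : 'I_n.-1) : j = i.+1 :> nat ->
    vB_rel (sv i ++ sg j ++ sv i) (sv j ++ sg i ++ sv j)
| vB_mixedV (i j : 'I_n.-1) : j = i.+1 :> nat ->
    vB_rel (sv i ++ sgV j ++ sv i) (sv j ++ sgV i ++ sv j)
| vB_mixed_far (i j : 'I_n.-1) : far i j -> vB_rel (sv i ++ sg j) (sg j ++ sv i).

Definition vB (n : nat) : groupType := presented (@vB_rel n).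

(* The quotient of <X | R> by further relations R' is <X | R, R'>. *)
Inductive fB_rel (n : nat) : word (vgen n) -> word (vgen n) -> Prop :=
| fB_vB (u v : word (vgen n)) : vB_rel u v -> fB_rel u v
| fB_sg_sqr (i : 'I_n.-1) : fB_rel (sg i ++ sg i) [::].

Definition fB (n : nat) : groupType := presented (@fB_rel n).

Section ToSym.
Variable n : nat.

Lemma adj_subproof (i : 'I_n.-1) : i.+1 < n.
Proof. by rewrite -ltn_predRL. Qed.

Definition adj_tperm (i : 'I_n.-1) : 'S_n :=
  tperm (widen_ord (leq_pred n) i) (Ordinal (adj_subproof i)).

Definition gen_perm (x : vgen n) : 'S_n :=
  match x with inl i => adj_tperm i | inr i => adj_tperm i end.

Lemma adj_braid (i j : 'I_n.-1) : j = i.+1 :> nat ->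
  adj_tperm i * (adj_tperm j * adj_tperm i) =
  adj_tperm j * (adj_tperm i * adj_tperm j).
Proof.
move=> ij; rewrite /adj_tperm.
set a := widen_ord _ i; set b := Ordinal _; set b' := widen_ord _ j.
set c := Ordinal _; have -> : b' = b by apply: val_inj; rewrite /= ij.
have ab : a != b by rewrite -val_eqE /= neq_ltn ltnSn.
have ac : a != c by rewrite -val_eqE /= ij neq_ltn ltnS leqnSn.
have bc : b != c by rewrite -val_eqE /= ij neq_ltn ltnSn.
have -> : tperm a b * (tperm b c * tperm a b) = tperm a c.
  by rewrite -{1}[tperm a b]tpermV -conjgE tpermJ tpermR tpermD // eq_sym.
rewrite -{1}[tperm b c]tpermV -conjgE tpermJ tpermL tpermD //.
  by rewrite eq_sym.
by rewrite eq_sym.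
Qed.

Lemma adj_far (i j : 'I_n.-1) : far i j ->
  adj_tperm i * adj_tperm j = adj_tperm j * adj_tperm i.
Proof.
move=> fij; rewrite /adj_tperm.
set a := widen_ord _ i; set b := Ordinal _; set c := widen_ord _ j.
set d := Ordinal _.
have H : [/\ a != c, a != d, b != c & b != d].
  by rewrite -!val_eqE /= !neq_ltn; case/orP: fij => h; split; apply/orP; lia.
case: H => ac ad bc bd.
rewrite [LHS]conjgC tpermJ !tpermD //; by rewrite eq_sym.
Qed.

Lemma adj_sqr (i : 'I_n.-1) : adj_tperm i * adj_tperm i = 1.
Proof. exact: tperm2. Qed.

Lemma gen_perm_rel u v : fB_rel u v -> weval gen_perm u = weval gen_perm v.
Proof.
case=> {u v} [_ _ [] *|i]; rewrite /= /leval /= !mulg1 ?tpermV.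
all: by [apply: adj_braid | apply: adj_far | apply: adj_sqr].
Qed.

Definition fB_perm : fB n -> 'S_n := pres_hom gen_perm.

Lemma fB_permM : {morph fB_perm : x y / x * y}.
Proof. exact: (pres_homM gen_perm_rel). Qed.

Lemma fB_perm1 : fB_perm 1 = 1.
Proof. exact: (pres_homE gen_perm_rel [::]). Qed.

HB.instance Definition _ :=
  isUMagmaMorphism.Build (fB n) 'S_n fB_perm (fB_perm1, fB_permM).

Definition PfB_pred : {pred fB n} := [pred x | fB_perm x == 1].

Lemma PfB_group_closed : group_closed PfB_pred.
Proof.
split=> [|x y]; rewrite !inE ?fB_perm1 // => /eqP x1 /eqP y1.
by rewrite fB_permM x1 mul1g -[fB_perm y^-1]mul1g -y1 -fB_permM mulgV fB_perm1 y1.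
Qed.

Definition PfB : Type := {x : fB n | x \in PfB_pred}.

HB.instance Definition _ := SubChoice.on PfB.
HB.instance Definition _ :=
  SubChoice_isSubGroup.Build (fB n) PfB_pred PfB PfB_group_closed.

Lemma PfB_conj_subproof (g : fB n) (x : PfB) : val x ^ g \in PfB_pred.
Proof.
have /eqP x1 := valP x.
by rewrite inE conjgE !fB_permM x1 mul1g -fB_permM mulVg fB_perm1.
Qed.

(* x |-> g^-1 x g *)
Definition PfB_conj (g : fB n) (x : PfB) : PfB := Sub (val x ^ g) (PfB_conj_subproof g x).

Lemma PfB_conjM (g : fB n) : {morph PfB_conj g : x y / x * y}.
Proof. by move=> x y; apply: val_inj; rewrite !(SubK, gmulfM) /= conjMg. Qed.

End ToSym.

Local Open Scope ring_scope.

(* Homogeneous cochains: G-invariant functions on G^(k+1), that is,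
   Hom_G(F_k, Q) for the standard free resolution F of the trivial module. *)
(* rat^o is rat seen as a vector space over itself. *)
Notation cochain G k := (('I_k.+1 -> G) -> rat^o).

Section Cohomology.
Variable G : groupType.

Definition ginvariant (k : nat) (f : cochain G k) : Prop :=
  forall (g : G) (x : 'I_k.+1 -> G), f (fun j => (g * x j)%g) = f x.

Definition cobound (k : nat) (f : cochain G k) : cochain G k.+1 := fun x =>
  \sum_(i < k.+2) (-1) ^+ i * f (fun j => x (lift i j)).

Definition is_cocycle (k : nat) (f : cochain G k) : Prop :=
  ginvariant f /\ cobound f = 0.

Definition is_coboundary (k : nat) : cochain G k -> Prop :=
  match k with
  | 0 => fun f => f = 0
  | _.+1 => fun f => exists2 h, ginvariant h & f = cobound h
  end.

Lemma coboundP k (a : rat) (f g : cochain G k) :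
  cobound (a *: f + g) = a *: cobound f + cobound g.
Proof.
apply/funext => x; rewrite -[RHS]/(a * cobound f x + cobound g x) /cobound.
rewrite mulr_sumr -big_split; apply: eq_bigr => i _ /=.
rewrite -[X in _ * X = _]/(a * f _ + g _).
by rewrite mulrDr mulrCA.
Qed.

Lemma ginvariantP k (a : rat) (f g : cochain G k) :
  ginvariant f -> ginvariant g -> ginvariant (a *: f + g).
Proof. by move=> fi gi h x; rewrite -[LHS]/(a * f _ + g _) fi gi. Qed.

Lemma ginvariant0 k : ginvariant (0 : cochain G k).
Proof. by []. Qed.

Lemma cobound0 k : cobound (0 : cochain G k) = 0.
Proof. by apply/funext => x; apply: big1 => i _; rewrite mulr0. Qed.

Section Degree.
Variable k : nat.

Definition cocycle_pred : {pred cochain G k} :=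
  fun f => `[< is_cocycle f >].

Lemma cocycle_submod : GRing.submod_closed cocycle_pred.
Proof.
split=> [|a f g /asboolP[fi fc] /asboolP[gi gc]]; apply/asboolP.
  by split; [exact: ginvariant0 | exact: cobound0].
by split; [exact: ginvariantP | rewrite coboundP fc gc scaler0 addr0].
Qed.

HB.instance Definition _ :=
  GRing.isSubmodClosed.Build rat (cochain G k) cocycle_pred
    cocycle_submod.

Definition cocycle : Type :=
  {f : cochain G k | f \in cocycle_pred}.

HB.instance Definition _ := SubChoice.on cocycle.
HB.instance Definition _ := [SubChoice_isSubLmodule of cocycle by <:].

Definition coboundary_pred : {pred cocycle} :=
  fun z => `[< is_coboundary (val z) >].

Lemma coboundary_submod : GRing.submod_closed coboundary_pred.
Proof.
have is_cob0 m : @is_coboundary m 0.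
  by case: m => //= m; exists 0; [exact: ginvariant0 | rewrite cobound0].
have is_cobP m (a : rat) f g : @is_coboundary m f -> is_coboundary g ->
    is_coboundary (a *: f + g).
  case: m f g => [|m] f g /=; first by move=> -> ->; rewrite scaler0 addr0.
  move=> [h hi ->] [h' hi' ->]; exists (a *: h + h'); first exact: ginvariantP.
  by rewrite coboundP.
split=> [|a f g /asboolP fb /asboolP gb]; apply/asboolP; first exact: is_cob0.
exact: is_cobP.
Qed.

HB.instance Definition _ :=
  GRing.isSubmodClosed.Build rat cocycle coboundary_pred coboundary_submod.

Definition cohomology : Type := Quotient.quot coboundary_pred.

HB.instance Definition _ := Quotient.on cohomology.
HB.instance Definition _ := GRing.Zmodule.on cohomology.

Definition coh_class (z : cocycle) : cohomology := \pi_(Quotient.quot coboundary_pred) z.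

Definition coh_repr (c : cohomology) : cocycle := generic_quotient.repr c.

Lemma coh_reprK : cancel coh_repr coh_class.
Proof. exact: reprK. Qed.

Lemma coh_classP (z z' : cocycle) :
  coh_class z = coh_class z' <-> is_coboundary (val (z - z')).
Proof.
have E : (z - z' \in coboundary_pred) = (coh_class z == coh_class z').
  exact: Quotient.idealrBE.
split=> [/eqP|b]; first by rewrite -E => /asboolP.
by apply/eqP; rewrite -E; apply/asboolP.
Qed.

Lemma coh_classD (z z' : cocycle) :
  coh_class (z + z') = coh_class z + coh_class z'.
Proof. exact: Quotient.pi_add. Qed.

Definition coh_scale (a : rat) (c : cohomology) : cohomology :=
  coh_class (a *: coh_repr c).

Lemma coh_scaleE a z : coh_scale a (coh_class z) = coh_class (a *: z).
Proof.
apply/coh_classP; rewrite -scalerBr; apply/asboolP.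
by apply: (rpredZ a (_ : _ \in coboundary_pred)); apply/asboolP/coh_classP; rewrite coh_reprK.
Qed.

Lemma coh_scaleA a b c : coh_scale a (coh_scale b c) = coh_scale (a * b) c.
Proof. by rewrite -(coh_reprK c) !coh_scaleE scalerA. Qed.

Lemma coh_scale1 : left_id 1 coh_scale.
Proof. by move=> c; rewrite -(coh_reprK c) coh_scaleE scale1r. Qed.

Lemma coh_scaleDr : right_distributive coh_scale +%R.
Proof.
move=> a c c'; rewrite -(coh_reprK c) -(coh_reprK c').
by rewrite -coh_classD !coh_scaleE -coh_classD scalerDr.
Qed.

Lemma coh_scaleDl c : {morph coh_scale^~ c : a b / a + b}.
Proof. by move=> a b; rewrite -(coh_reprK c) !coh_scaleE -coh_classD scalerDl. Qed.

HB.instance Definition _ := GRing.Zmodule_isLmodule.Build rat cohomology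
  coh_scaleA coh_scale1 coh_scaleDr coh_scaleDl.

Lemma coh_classZ a z : coh_class (a *: z) = a *: coh_class z.
Proof. by rewrite -coh_scaleE. Qed.

End Degree.
End Cohomology.

Section Functoriality.
Variables (G H : groupType) (phi : {multiplicative H -> G}) (k : nat).

Definition pull (m : nat) (f : cochain G m) : cochain H m :=
  fun x => f (fun j => phi (x j)).

Lemma pull_ginvariant m (f : cochain G m) :
  ginvariant f -> ginvariant (pull f).
Proof.
move=> fi h x; rewrite /pull -(fi (phi h) (fun j => phi (x j))).
by congr f; apply/funext => j; rewrite gmulfM.
Qed.

Lemma pull_cobound m (f : cochain G m) :
  pull (cobound f) = cobound (pull f).
Proof. by []. Qed.

Lemma pull_cocycle_subproof (z : cocycle G k) :
  pull (val z) \in @cocycle_pred H k.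
Proof.
have /asboolP[zi zc] := valP z; apply/asboolP; split.
  exact: pull_ginvariant.
by rewrite -pull_cobound zc.
Qed.

Definition pull_cocycle (z : cocycle G k) : cocycle H k :=
  Sub (pull (val z)) (pull_cocycle_subproof z).

Definition coh_pull (c : cohomology G k) : cohomology H k :=
  coh_class (pull_cocycle (coh_repr c)).

Lemma pull_coboundary m (f : cochain G m) :
  is_coboundary f -> is_coboundary (pull f).
Proof.
case: m f => [|m] f /=; first by move=> ->.
by move=> [h hi ->]; exists (pull h); first exact: pull_ginvariant.
Qed.

Lemma coh_pullE z : coh_pull (coh_class z) = coh_class (pull_cocycle z).
Proof.
apply/coh_classP.
rewrite -[val _]/(pull (val (coh_repr (coh_class z) - z))).
by apply/pull_coboundary/coh_classP; rewrite coh_reprK.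
Qed.

Lemma coh_pull_linear : linear coh_pull.
Proof.
move=> a c c'; rewrite -(coh_reprK c) -(coh_reprK c').
rewrite -coh_classZ -coh_classD !coh_pullE -coh_classZ -coh_classD.
by congr coh_class; apply: val_inj.
Qed.

HB.instance Definition _ :=
  GRing.isLinear.Build rat (cohomology G k) (cohomology H k) _ coh_pull
    coh_pull_linear.

End Functoriality.

Section SymAction.
Variables (n k : nat).

HB.instance Definition _ (g : fB n) :=
  isMultiplicative.Build (PfB n) (PfB n) (PfB_conj g) (@PfB_conjM n g).

(* The left action of g in fB_n: (g . f)(x_0, ..., x_k) =
   f(g^-1 x_0 g, ..., g^-1 x_k g) on cochains. *)
Definition PfB_act (g : fB n) (c : cohomology (PfB n) k) : cohomology (PfB n) k :=
  coh_pull (PfB_conj g) c.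

(* S_n = fB_n / PfB_n: the permutation s acts through any g in fB_n over s
   (elements of PfB_n act trivially on the cohomology of PfB_n). *)
Definition Sn_invariant : {pred cohomology (PfB n) k} :=
  fun c => `[< forall (s : 'S_n) (g : fB n), fB_perm g = s -> PfB_act g c = c >].

Lemma Sn_invariant_submod : GRing.submod_closed Sn_invariant.
Proof.
split=> [|a c c' /asboolP ci /asboolP ci']; apply/asboolP => s g gs.
  by rewrite /PfB_act linear0.
rewrite /PfB_act linearP.
by congr (_ *: _ + _); [exact: ci gs | exact: ci' gs].
Qed.

HB.instance Definition _ :=
  GRing.isSubmodClosed.Build rat (cohomology (PfB n) k) Sn_invariant
    Sn_invariant_submod.

Definition Sn_invariants : Type :=
  {c : cohomology (PfB n) k | c \in Sn_invariant}.

HB.instance Definition _ := SubChoice.on Sn_invariants.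
HB.instance Definition _ := [SubChoice_isSubLmodule of Sn_invariants by <:].

End SymAction.

Definition lmod_iso (R : pzRingType) (U V : lmodType R) : Prop :=
  exists f : {linear U -> V}, bijective f.

(* Main.v *)
Require Import Defs.
From HB Require Import structures.
From mathcomp Require Import all_boot all_algebra all_fingroup.
From mathcomp Require Import boolp functions zify ring.
Import GRing.Theory Num.Theory.

(* Let V be the finite subgroup of fB_n generated by the s_i, and R the finite
   set of V-conjugates of the sigma_i.  The subgroup W generated by R is a Coxeter
   group on R (this is witnessed by the reflection cocycle N : fB_n -> F_2^(fB_n),
   with N(sigma_i) = indicator of sigma_i and N(s_i) = 0, which gives the exchange
   condition without a presentation of W), and fB_n = W V.  Coxeter groups are
   rationally acyclic, by induction on the rank: a finite one by averaging, and an
   infinite one because its Coxeter complex is contractible, which gives a double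
   complex with exact rows and, by induction, exact columns.  Averaging over V
   gives H^k(fB_n) = 0 for k >= 1, and a transfer from PfB_n to fB_n then kills the
   S_n-invariants of H^k(PfB_n). *)

Set Implicit Arguments.
Unset Strict Implicit.
Unset Printing Implicit Defensive.

Local Open Scope ring_scope.

(** * Complexes of functions on finite sequences *)

Section Differential.
Variable A : eqType.
Implicit Types (f g : seq A -> rat) (t : seq A).

Fixpoint sdiff f t : rat :=
  if t is x :: t' then f t' - sdiff (fun u => f (x :: u)) t' else 0.

(** The length condition lets functions be compared in a single degree, which the later truncations
    by degree rely on. *)
Lemma eq_sdiff f g t :
  (forall u, subseq u t -> (size u).+1 = size t -> f u = g u) ->
  sdiff f t = sdiff g t.
Proof.
elim: t f g => // x t IHt f g fg.
rewrite [LHS]/= [RHS]/= (fg t (subseq_cons t x) erefl); congr (_ - _).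
by apply: IHt => u ut su; rewrite fg /= ?eqxx // su.
Qed.

Lemma sdiff0 t : sdiff (fun=> 0) t = 0.
Proof. by elim: t => //= x t ->; rewrite subr0. Qed.

Lemma sdiffB f g t : sdiff (fun u => f u - g u) t = sdiff f t - sdiff g t.
Proof. by elim: t f g => [|x t IHt] f g /=; rewrite ?subr0 // IHt; ring. Qed.

Lemma sdiffD f g t : sdiff (fun u => f u + g u) t = sdiff f t + sdiff g t.
Proof. by elim: t f g => [|x t IHt] f g /=; rewrite ?addr0 // IHt; ring. Qed.

Lemma sdiffZ a f t : sdiff (fun u => a * f u) t = a * sdiff f t.
Proof. by elim: t f => [|x t IHt] f /=; rewrite ?mulr0 // IHt; ring. Qed.

Lemma sdiff_sum (J : Type) (r : seq J) (F : J -> seq A -> rat) t :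
  sdiff (fun u => \sum_(j <- r) F j u) t = \sum_(j <- r) sdiff (F j) t.
Proof.
elim: r => [|j r IHr].
  by rewrite big_nil -[RHS](sdiff0 t); apply: eq_sdiff => *; rewrite big_nil.
rewrite big_cons -IHr -sdiffD; apply: eq_sdiff => u _ _.
by rewrite big_cons.
Qed.

Lemma sdiffK f t : sdiff (sdiff f) t = 0.
Proof.
elim: t f => //= x t IHt f.
by rewrite (sdiffB f) IHt subr0 subrr.
Qed.

Lemma sdiff_map f (h : A -> A) t :
  sdiff (fun u => f (map h u)) t = sdiff f (map h t).
Proof.
by elim: t f => //= x t IHt f; rewrite (IHt (fun u => f (h x :: u))).
Qed.

(** The cone at [x] contracts the complex, though not equivariantly; averaging repairs this
    later. *)
Lemma sdiff_cone x f t :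
  (forall u, sdiff f u = 0) -> sdiff (fun u => f (x :: u)) t = f t.
Proof. by move=> /(_ (x :: t)) /= /subr0_eq. Qed.

Lemma sdiffE f t : sdiff f t =
  \sum_(0 <= i < size t) (-1) ^+ i * f (take i t ++ drop i.+1 t).
Proof.
elim: t f => [|x t IHt] f /=; first by rewrite big_geq.
rewrite big_nat_recl //= expr0 mul1r drop0 IHt -sumrN; congr (_ + _).
by apply: eq_bigr => i _; rewrite exprS mulN1r mulNr.
Qed.

End Differential.

Lemma sdiffC (A B : eqType) (F : seq A -> seq B -> rat) t u :
  sdiff (fun t => sdiff (F t) u) t = sdiff (fun u => sdiff (F^~ u) t) u.
Proof.
elim: t F => [|x t IHt] F /=; first by rewrite sdiff0.
by rewrite IHt sdiffB.
Qed.

(** * Exactness of the rows: a shelling of the Coxeter complex *)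

Section RowExactness.
Variables (I : eqType) (X : Type) (T : seq I) (act : I -> X -> X).
Variables (len : X -> nat) (desc : I -> X -> bool) (nf : seq I -> X -> X).

Definition invariant (U : seq I) (f : X -> rat) :=
  forall i, i \in U -> forall x, f (act i x) = f x.

Definition off (t : seq I) : seq I := [seq i <- T | i \notin t].

Lemma mem_off t i : (i \in off t) = (i \notin t) && (i \in T).
Proof. by rewrite mem_filter. Qed.

Lemma off_sub t u : {subset u <= t} -> {subset off t <= off u}.
Proof.
by move=> ut i; rewrite !mem_off => /andP[it ->]; rewrite (contraNN (@ut i)).
Qed.

(** In the Coxeter complex with vertex types [T], the orbit of a chamber under the group spanned by
    [off t] is a simplex of type [t], so [F t] is a function on these simplices. *)
Definition cech (F : seq I -> X -> rat) :=
  forall t, {subset t <= T} -> invariant (off t) (F t).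

Lemma cech_sdiff F : cech F -> cech (fun t x => sdiff (F^~ x) t).
Proof.
move=> cF t tT i it x; apply: eq_sdiff => u /mem_subseq ut _.
by apply: cF (off_sub ut it) _ => j /ut/tT.
Qed.

(** The model for [nf U x] is the shortest element of the orbit of [x] under the group spanned by
    [U]; [no_longest] is the feature of an infinite Coxeter group. *)
Hypothesis act_desc : forall i x, i \in T -> desc i x -> (len (act i x) < len x)%N.
Hypothesis nf_act : forall (U : seq I) i x, {subset U <= T} -> i \in U ->
  nf U (act i x) = nf U x.
Hypothesis nf_id : forall (U : seq I) x, {subset U <= T} ->
  (forall i, i \in U -> ~~ desc i x) -> nf U x = x.
Hypothesis nf_desc : forall (U : seq I) i x, {subset U <= T} -> i \in U ->
  ~~ desc i (nf U x).
Hypothesis nf_inv : forall (U : seq I) f x, {subset U <= T} -> invariant U f ->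
  f (nf U x) = f x.
Hypothesis len_nf : forall (U : seq I) x, {subset U <= T} -> (len (nf U x) <= len x)%N.
Hypothesis no_longest : forall x, exists2 i, i \in T & ~~ desc i x.

Lemma off_subT t : {subset off t <= T}.
Proof. by move=> i; rewrite mem_off => /andP[]. Qed.

Definition ascent (x : X) : I := projT1 (cid2 (no_longest x)).

Lemma ascentT x : ascent x \in T.
Proof. by rewrite /ascent; case: cid2. Qed.

Lemma ascent_desc x : ~~ desc (ascent x) x.
Proof. by rewrite /ascent; case: cid2. Qed.

(** Here [m] is the shortest chamber containing the simplex of type [t] of [x]. Chambers are
    attached by increasing length, and each new simplex is coned off from the vertex of type
    [ascent m] of that chamber. *)
Definition layer (F : seq I -> X -> rat) (r : nat) (t : seq I) (x : X) : rat :=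
  let m := nf (off t) x in if len m == r then F (ascent m :: t) m else 0.

Definition peel F r t x : rat := F t x - sdiff (fun u => layer F r u x) t.

Lemma layer_cech F r : cech (layer F r).
Proof. by move=> t tT i it x; rewrite /layer nf_act //; apply: off_subT. Qed.

Lemma layer_big F r t x : (len x < r)%N -> layer F r t x = 0.
Proof.
move=> xr; rewrite /layer ltn_eqF // (leq_ltn_trans _ xr) // len_nf //.
exact: off_subT.
Qed.

Definition row_cocycle (F : seq I -> X -> rat) :=
  forall t : seq I, {subset t <= T} -> forall x, sdiff (F^~ x) t = 0.

Lemma peel_cech F r : cech F -> cech (peel F r).
Proof.
move=> cF t tT i it x; rewrite /peel (cF t tT i it).
by rewrite (cech_sdiff (@layer_cech F r)).
Qed.

Lemma peel_cocycle F r : row_cocycle F -> row_cocycle (peel F r).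
Proof.
by move=> dF t tT x; rewrite sdiffB dF // (sdiffK (fun u => layer F r u x)) subr0.
Qed.

Lemma nf_lt U x i : {subset U <= T} -> i \in U -> desc i x ->
  (len (nf U x) < len x)%N.
Proof.
move=> UT iU ix; rewrite -(nf_act _ UT iU).
exact: leq_ltn_trans (len_nf _ UT) (act_desc (UT _ iU) ix).
Qed.

(** At a chamber [x] of length [r], the cocycle condition on [ascent x :: t] writes [F t x] as the
    differential of the cone from [ascent x], and this cone agrees with [layer F r] on all faces [u]
    of [t]. *)
Lemma peel_vanish F r : cech F -> row_cocycle F ->
  (forall t, {subset t <= T} -> forall x, (len x < r)%N -> F t x = 0) ->
  forall t, {subset t <= T} -> forall x, (len x <= r)%N -> peel F r t x = 0.
Proof.
move=> cF dF F0 t tT x0 x0r.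
rewrite -(nf_inv x0 (@off_subT t) (peel_cech r cF tT)).
have := @nf_desc (off t) ^~ x0; have : (len (nf (off t) x0) <= r)%N.
  by apply: leq_trans x0r; apply: len_nf; apply: off_subT.
move: (nf _ _) => {x0 x0r} x xr nd.
rewrite leq_eqVlt in xr; case/orP: xr => [/eqP xr|xr]; last first.
  rewrite /peel F0 // sub0r; apply/eqP; rewrite oppr_eq0; apply/eqP.
  by rewrite -[RHS](sdiff0 t); apply: eq_sdiff => u _ _; rewrite layer_big.
have stT : {subset ascent x :: t <= T}.
  by move=> i; rewrite inE => /predU1P[->|/tT//]; apply: ascentT.
have /= /subr0_eq Ft := dF _ stT x.
rewrite /peel Ft -sdiffB -[RHS](sdiff0 t); apply: eq_sdiff => u /mem_subseq ut _.
apply/eqP; rewrite subr_eq0; apply/eqP; rewrite /layer.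
have suT : {subset ascent x :: u <= T}.
  by move=> i; rewrite inE => /predU1P[->|/ut/tT//]; apply: ascentT.
(* If a descent [i] lies in [off u], the layer is 0 because the normal form is shorter than [r]. As
   [i] differs from the ascent, the simplex of type [ascent x :: u] also lies in the shorter chamber
   [act i x], where [F] vanishes. *)
case: (pselect (exists2 i, i \in off u & desc i x)) => [[i iu ix]|nix].
  rewrite (ltn_eqF (_ : (_ < r)%N)); last by rewrite -xr (nf_lt (@off_subT u) iu).
  have iT := off_subT iu.
  have iu' : i \in off (ascent x :: u).
    rewrite mem_off iT andbT inE negb_or; move: iu; rewrite mem_off => /andP[-> _].
    by rewrite andbT; apply: contraL ix => /eqP ->; apply: ascent_desc.
  by rewrite -(cF _ suT _ iu') F0 // -xr act_desc.
rewrite nf_id ?xr ?eqxx //; first exact: off_subT.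
by move=> i iu; apply/negP => ix; apply: nix; exists i.
Qed.

Definition peels F r := iteri r (fun k H => peel H k) F.

Lemma peelsP F r : cech F -> row_cocycle F ->
  [/\ cech (peels F r), row_cocycle (peels F r) &
    forall t, {subset t <= T} -> forall x, (len x < r)%N -> peels F r t x = 0].
Proof.
move=> cF dF; elim: r => [|r [cr dr vr]]; first by split.
split; [exact: peel_cech|exact: peel_cocycle|].
by move=> t tT x; rewrite ltnS; apply: peel_vanish.
Qed.

(* The contraction is built one length at a time: [layer] kills the values at
   normal forms of length [r], and at each [x] only one length contributes. *)
Lemma row_exact F : cech F -> row_cocycle F ->
  exists2 H, cech H & forall t, {subset t <= T} -> forall x,
    sdiff (H^~ x) t = F t x.
Proof.
move=> cF dF.
exists (fun t x => layer (peels F (len (nf (off t) x))) (len (nf (off t) x)) t x).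
  move=> t tT i it x; rewrite /= !nf_act //; last exact: off_subT.
  exact: layer_cech.
move=> t tT x; pose n := len x.
transitivity (\sum_(0 <= r < n.+1) sdiff (fun u => layer (peels F r) r u x) t).
  rewrite -sdiff_sum; apply: eq_sdiff => u _ _.
  (* The length [m] depends on the face [u] but never exceeds [len x], so one sum over [r] serves
     all faces. *)
  set m := len _; have mn : (m < n.+1)%N by rewrite ltnS len_nf //; apply: off_subT.
  rewrite (bigD1_seq m) ?iota_uniq ?mem_index_iota //= big1 ?addr0 // => r rm.
  by rewrite /layer -/m eq_sym (negPf rm).
transitivity (\sum_(0 <= r < n.+1) (peels F r t x - peels F r.+1 t x)).
  by apply: eq_bigr => r _; rewrite [peels F r.+1]/(peel _ r) /peel opprB addrC subrK.
have [_ _ v0] := peelsP n.+1 cF dF.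
transitivity (peels F 0 t x - peels F n.+1 t x); last by rewrite v0 // subr0.
elim: n.+1 {v0} => [|r IHr]; first by rewrite big_geq // subrr.
by rewrite big_nat_recr //= IHr addrA subrK.
Qed.

End RowExactness.

(** * Groups generated by reflections *)

Section Words.
Variable G : groupType.
Local Open Scope group_scope.

Definition prodw (w : seq G) : G := foldr mulg 1 w.

Lemma prodw_cat u v : prodw (u ++ v) = prodw u * prodw v.
Proof. by elim: u => /= [|a u ->]; rewrite ?mul1g ?mulgA. Qed.

(** Words contain no inverses; for involutions this is still the generated subgroup, by [spansV]. *)
Definition spans (U : seq G) (g : G) : Prop :=
  exists2 w : seq G, {subset w <= U} & prodw w = g.

Lemma spans1 U : spans U 1.
Proof. by exists [::]. Qed.

Lemma spans_gen U s : s \in U -> spans U s.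
Proof.
by move=> sU; exists [:: s]; rewrite /= ?mulg1 // => a; rewrite inE => /eqP ->.
Qed.

Lemma spansM U g h : spans U g -> spans U h -> spans U (g * h).
Proof.
move=> [u uU <-] [v vU <-]; exists (u ++ v); last exact: prodw_cat.
by move=> a; rewrite mem_cat => /orP[/uU|/vU].
Qed.

Lemma spansV U g : (forall s, s \in U -> s * s = 1) -> spans U g -> spans U g^-1.
Proof.
move=> U2 [w wU <-]; elim: w wU => [|a w IHw] wU; first by rewrite invg1; apply: spans1.
have aU : a \in U by apply: wU; rewrite inE eqxx.
have -> : (prodw (a :: w))^-1 = (prodw w)^-1 * a.
  by rewrite /= invgM -[in RHS](mulgK a a) (U2 _ aU) mul1g.
apply: spansM; last exact: spans_gen.
by apply: IHw => b bw; apply: wU; rewrite inE bw orbT.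
Qed.

End Words.

(** * Acyclicity by averaging and by a double complex *)

Section Acyclicity.
Variable G : groupType.
Implicit Types (U T : seq G) (f h : seq G -> rat) (x : seq G).

Definition lmul (s : G) (x : seq G) : seq G := [seq (s * y)%g | y <- x].

Lemma lmulM s t x : lmul s (lmul t x) = lmul (s * t)%g x.
Proof. by rewrite /lmul -map_comp; apply: eq_map => y; rewrite /= mulgA. Qed.

Lemma lmul1 x : lmul 1%g x = x.
Proof. by rewrite -[RHS]map_id; apply: eq_map => y; rewrite mul1g. Qed.

Lemma invariant_spans U f g x :
  invariant lmul U f -> spans U g -> f (lmul g x) = f x.
Proof.
move=> fU [w wU <-]; elim: w wU => [|s w IHw] wU; first by rewrite lmul1.
rewrite /= -lmulM fU; last by apply: wU; rewrite inE eqxx.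
by apply: IHw => a aw; apply: wU; rewrite inE aw orbT.
Qed.

Lemma invariant_sdiff U h : invariant lmul U h -> invariant lmul U (sdiff h).
Proof.
by move=> hU s sU x; rewrite -sdiff_map; apply: eq_sdiff => u _ _; apply: hU.
Qed.

Definition average (E : seq G) h x : rat :=
  (size E)%:R^-1 * \sum_(e <- E) h (lmul e x).

Lemma average_inv E h s x : uniq E -> {in E, forall e, (e * s)%g \in E} ->
  average E h (lmul s x) = average E h x.
Proof.
move=> uE sE; congr (_ * _).
have pE : perm_eq [seq (e * s)%g | e <- E] E.
  have um : uniq [seq (e * s)%g | e <- E] by rewrite map_inj_uniq //; apply: mulIg.
  have sm : {subset [seq (e * s)%g | e <- E] <= E} by move=> _ /mapP[e eE ->]; apply: sE.
  by apply: uniq_perm => //; apply: (uniq_min_size um sm _).2; rewrite size_map leqnn.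
rewrite -[RHS](perm_big _ pE) big_map; apply: eq_bigr => e _.
by rewrite lmulM.
Qed.

Lemma average_const E f x : (0 < size E)%N -> {in E, forall e, f (lmul e x) = f x} ->
  average E f x = f x.
Proof.
move=> E0 fE; rewrite /average (eq_big_seq (fun=> f x)) //.
rewrite big_const_seq count_predT iter_addr_0 -[f x *+ _]mulr_natl mulrA mulVf ?mul1r //.
by rewrite pnatr_eq0 -lt0n.
Qed.

Lemma average_sdiff E h x : sdiff (average E h) x = average E (sdiff h) x.
Proof.
rewrite sdiffZ sdiff_sum; congr (_ * _); apply: eq_bigr => e _.
exact: sdiff_map.
Qed.

(* The augmented complex of homogeneous cochains: the degree -1 term is the
   value at the empty sequence, so exactness includes H^0 = Q. *)
Definition acyclic U := forall f, invariant lmul U f ->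
  (forall x, sdiff f x = 0) ->
  exists2 h, invariant lmul U h & forall x, sdiff h x = f x.

(** Averaging over [E] makes the cone at 1 invariant and leaves the already invariant [f]
    unchanged. *)
Lemma acyclic_average U E : uniq E -> (0 < size E)%N ->
  {in E, forall e s, s \in U -> (e * s)%g \in E} ->
  (forall e, e \in E -> spans U e) -> acyclic U.
Proof.
move=> uE E0 EU sE f fU df; exists (average E (fun x => f (1%g :: x))).
  by move=> s sU x; apply: average_inv => // e eE; apply: EU.
move=> x; rewrite average_sdiff -[RHS](average_const E0).
  by congr (_ * _); apply: eq_bigr => e _; apply: sdiff_cone.
by move=> e /sE eU; apply: invariant_spans eU.
Qed.

Section Staircase.
Variable T : seq G.
Hypothesis row : forall F, cech T lmul F -> row_cocycle T F ->
  exists2 H, cech T lmul H & forall t : seq G, {subset t <= T} -> forall x,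
    sdiff (H^~ x) t = F t x.
Hypothesis column : forall U, {subset U <= T} -> (size U < size T)%N -> acyclic U.
Variable a : G.
Hypothesis aT : a \in T.

Lemma size_off b (t : seq G) : {subset b :: t <= T} -> (size (off T (b :: t)) < size T)%N.
Proof.
move=> tT; rewrite size_filter ltn_neqAle count_size andbT -all_count -has_predC.
apply/hasP; exists b; first by apply: tT; rewrite inE eqxx.
by rewrite /= inE eqxx.
Qed.

(** A zigzag, by induction on the degree in [x]. The row differential [D] of a column primitive [K]
    is closed in both directions; induction gives a row-closed column primitive [P] of [D], and a
    row primitive [Q] of [P] corrects [K] to a row-closed function. *)
Lemma staircase m F : cech T lmul F -> row_cocycle T F ->
  (forall t : seq G, {subset t <= T} -> forall x, sdiff (F t) x = 0) ->
  exists2 H, cech T lmul H /\ row_cocycle T H &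
    forall t : seq G, {subset t <= T} -> forall x, (size x <= m)%N -> sdiff (H t) x = F t x.
Proof.
elim: m F => [|m IHm] F cF rF dF.
  exists (fun _ _ => 0); first by split => // t tT x; apply: sdiff0.
  by move=> t tT [] // _; have := dF t tT [:: 1%g]; rewrite /= subr0.
have /choice[K KP] : forall t : seq G, exists h : seq G -> rat, {subset t <= T} ->
    invariant lmul (off T t) h /\ (forall x, sdiff h x = F t x).
  move=> t.
  case: (pselect {subset t <= T}) => tT; last by exists (fun=> 0).
  case: t tT => [|b t] tT.
    (* For empty [t], [off t] is all of [T], out of reach of [column]; but row-closedness at
       [[:: a]] forces [F [::]] to be 0. *)
    exists (fun=> 0) => _; split=> // x; rewrite sdiff0.
    have aT' : {subset [:: a] <= T} by move=> i; rewrite inE => /eqP ->.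
    by have := rF [:: a] aT' x; rewrite /= subr0.
  have [h hU dh] := column (@off_subT _ T (b :: t)) (size_off tT) (cF _ tT) (dF _ tT).
  by exists h.
have cK : cech T lmul K by move=> t /KP[].
pose D t x := sdiff (K^~ x) t.
have sub (t u : seq G) : {subset t <= T} -> subseq u t -> {subset u <= T}.
  by move=> tT /mem_subseq ut i /ut/tT.
have [||t tT x|P [cP rP] dP] := IHm D.
- exact: cech_sdiff cK.
- by move=> t tT x; apply: (sdiffK (K^~ x)).
- rewrite (sdiffC (fun x t => K t x)) -(rF t tT x).
  by apply: eq_sdiff => u ut _; case: (KP u (sub _ _ tT ut)).
have [Q cQ dQ] := row cP rP.
(* [P] solves its equation only up to length [m], hence the truncation. The differential at length
   [m.+1] reads only lengths at most [m]. *)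
pose H t x := if (size x <= m)%N then K t x - sdiff (Q t) x else 0.
exists H; first split.
- move=> t tT s st x; rewrite /H size_map; case: ifP => // _.
  by rewrite (cK _ tT _ st) (invariant_sdiff (cQ _ tT)).
- move=> t tT x; rewrite /H; case: (leqP (size x) m) => xm; last exact: sdiff0.
  rewrite sdiffB -[X in X - _]/(D t x) -dP // sdiffC -sdiffB -[RHS](sdiff0 x).
  by apply: eq_sdiff => u _ _; rewrite dQ // subrr.
move=> t tT x xm; rewrite /H; case: (KP t tT) => _ <-.
transitivity (sdiff (fun u => K t u - sdiff (Q t) u) x).
  by apply: eq_sdiff => u _ ux; rewrite -ltnS ux xm.
by rewrite sdiffB sdiffK subr0.
Qed.

Lemma acyclic_rows : acyclic T.
Proof.
move=> f fT df.
suff : forall m, exists h, invariant lmul T h /\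
    forall x, (size x <= m)%N -> sdiff h x = f x.
  (* The primitives for different [m] need not agree. The differential at [x] reads only sequences
     one shorter, where the glued function is [h (size x)]. *)
  move=> /choice[h hP]; exists (fun x => h (size x).+1 x).
    by move=> s sT x; rewrite size_map; apply: (hP _).1.
  move=> x; rewrite -((hP (size x)).2 x) //.
  by apply: eq_sdiff => u _ ->.
(* The row differential of [F0] is the image of [f] under the augmentation into the double complex;
   it equals [f] at every [[:: b]]. *)
move=> m; pose F0 (t : seq G) x := if t is [::] then f x else 0.
have cF0 : cech T lmul F0.
  move=> [|b t] tT s; rewrite ?mem_off //= => sT x; exact: fT.
have [||t tT x|P [cP rP] dP] := @staircase m (fun t x => sdiff (F0^~ x) t).
- exact: cech_sdiff cF0.
- by move=> t tT x; apply: (sdiffK (F0^~ x)).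
- rewrite (sdiffC (fun x t => F0 t x)) -[RHS](sdiff0 t); apply: eq_sdiff => -[|b u] _ _.
    exact: df.
  exact: sdiff0.
have [Q cQ dQ] := row cP rP; exists (Q [::]); split=> [s sT|x xm].
  by apply: (cQ [::]); rewrite // mem_off.
have aT' : {subset [:: a] <= T} by move=> i; rewrite inE => /eqP ->.
have := dP _ aT' x xm; rewrite /= subr0 => <-; apply: eq_sdiff => u _ _.
by have := dQ _ aT' u; rewrite /= subr0.
Qed.

End Staircase.
End Acyclicity.

(** * Exchange condition and parabolic cosets from a reflection cocycle *)

Section Reflections.
Variables (G : groupType) (N : G -> G -> bool) (S : seq G).
Local Open Scope group_scope.

(** Letters on which [N] vanishes are allowed in words but count for nothing in [len]. *)
Definition letter (a : G) : Prop := a \in S \/ (forall x, N a x = false).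

Hypothesis NM : forall g h x, N (g * h) x = N g x (+) N h (x ^ g).
Hypothesis NS : forall s x, s \in S -> N s x = (x == s).
Hypothesis SS : forall s, s \in S -> s * s = 1.
Hypothesis genG :
  forall g, exists2 w, (forall a, a \in w -> letter a) & prodw w = g.

Lemma N1 x : N 1 x = false.
Proof. by have := NM 1 1 x; rewrite mulg1 conjg1; case: (N 1 x). Qed.

Lemma N_descent s g : s \in S -> N (s * g) s = ~~ N g s.
Proof. by move=> sS; rewrite NM NS // eqxx conjgE mulKg addTb. Qed.

(** By the cocycle rule, [t] is either the first letter, which is then deleted, or its conjugate by
    that letter is an inversion of the rest of the word. *)
Lemma exchange (w : seq G) t : (forall a, a \in w -> letter a) -> N (prodw w) t ->
  exists2 w', subseq w' w &
    prodw w' = t * prodw w /\ (count (mem S) w' < count (mem S) w)%N.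
Proof.
elim: w t => [|a w IHw] t lw /=; first by rewrite N1.
rewrite NM; case Nat: (N a t) => /=.
  have [aS|] := lw a (mem_head _ _); last by move=> /(_ t); rewrite Nat.
  move: Nat; rewrite NS // => /eqP -> _; exists w; first exact: subseq_cons.
  by rewrite mulgA SS // mul1g aS add1n.
move=> /IHw [b bw|w' w'w [pw' cw']].
  by apply: lw; rewrite inE bw orbT.
exists (a :: w'); first by rewrite /= eqxx.
split; last by rewrite /= ltn_add2l.
by rewrite /= pw' conjgE !mulgA mulgV mul1g.
Qed.

Lemma ex_len g : exists n, `[< exists w, [/\ forall a, a \in w -> letter a,
  prodw w = g & count (mem S) w = n] >].
Proof.
by have [w lw pw] := genG g; exists (count (mem S) w); apply/asboolP; exists w.
Qed.

Definition len (g : G) : nat := ex_minn (ex_len g).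

Lemma len_exchange g t : N g t -> (len (t * g) < len g)%N.
Proof.
rewrite /len; case: ex_minnP => m _ mmin; case: ex_minnP => n /asboolP[w [lw pw cw]] _.
rewrite -pw => /(exchange lw) [w' w'w [pw' cw']].
apply: leq_ltn_trans (mmin (count (mem S) w') _) _; last by rewrite -cw.
apply/asboolP; exists w'; split => //; last by rewrite pw' pw.
by move=> a /(mem_subseq w'w)/lw.
Qed.

Section Parabolic.
Variable U : seq G.
Hypothesis US : {subset U <= S}.

Lemma lettersU (w : seq G) : {subset w <= U} -> forall a, a \in w -> letter a.
Proof. by move=> wU a /wU/US; left. Qed.

Lemma countU (w : seq G) : {subset w <= U} -> count (mem S) w = size w.
Proof. by move=> wU; apply/eqP; rewrite -all_count; apply/allP => a /wU/US. Qed.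

Lemma exchangeU (w : seq G) t : {subset w <= U} -> N (prodw w) t ->
  exists2 w', {subset w' <= U} & prodw w' = t * prodw w /\ (size w' < size w)%N.
Proof.
move=> wU /(exchange (lettersU wU)) [w' w'w [pw' cw']].
have w'U : {subset w' <= U} by move=> a /(mem_subseq w'w)/wU.
by exists w' => //; split => //; rewrite -!countU.
Qed.

Lemma spansUV g : spans U g -> spans U g^-1.
Proof. by apply: spansV => s /US/SS. Qed.

(** If the first letter [s] is not a descent of the product, it is a descent of the remaining word,
    and exchange gives a shorter word for the same element. *)
Lemma no_descent1 g : spans U g -> (forall s, s \in U -> N g s = false) -> g = 1.
Proof.
move=> [w wU <-]; have [n] := ubnP (size w); elim: n w wU => // n IHn [|s w] wU wn nd //.
have sU : s \in U by apply: wU; rewrite inE eqxx.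
have w_U : {subset w <= U} by move=> a aw; apply: wU; rewrite inE aw orbT.
have Ns : N (prodw w) s by have := nd s sU; rewrite /= N_descent ?US // => /negbFE.
have [w' w'U [pw' sw']] := exchangeU w_U Ns.
rewrite -[prodw _]/(s * prodw w) -pw'; apply: (IHn w' w'U); last by rewrite pw'.
exact: leq_trans sw' (ltnW wn).
Qed.

Definition coset_minimal m := forall w, spans U w -> (len m <= len (w * m))%N.

Lemma ex_coset_minimal x : exists2 w, spans U w & coset_minimal (w * x).
Proof.
have exP : exists n, `[< exists2 w, spans U w & len (w * x) = n >].
  by exists (len (1 * x)); apply/asboolP; exists 1; first exact: spans1.
case: (ex_minnP exP) => n /asboolP[w wU <-] wmin; exists w => // v vU.
by apply: wmin; apply/asboolP; exists (v * w); [exact: spansM|rewrite mulgA].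
Qed.

Lemma minimal_N m t : coset_minimal m -> spans U t -> N m t = false.
Proof.
by move=> mmin tU; apply/negP => /len_exchange; rewrite ltnNge mmin.
Qed.

(** [N m] vanishes on the span of [U], so [w * m] and [w] have the same descents in [U]. *)
Lemma minimal_uniq m w : coset_minimal m -> spans U w ->
  (forall s, s \in U -> N (w * m) s = false) -> w = 1.
Proof.
move=> mmin wU nd; apply: no_descent1 => // s sU.
have := nd s sU; rewrite NM (@minimal_N m) ?addbF // conjgE.
apply: spansM; last exact: spansM (spans_gen sU) wU.
exact: spansUV.
Qed.

Definition to_min (x : G) : G := projT1 (cid2 (ex_coset_minimal x)).

Lemma to_min_spans x : spans U (to_min x).
Proof. by rewrite /to_min; case: cid2. Qed.

Lemma to_min_minimal x : coset_minimal (to_min x * x).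
Proof. by rewrite /to_min; case: cid2. Qed.

Lemma to_min_desc x s : s \in U -> N (to_min x * x) s = false.
Proof. by move=> sU; apply: minimal_N (@to_min_minimal x) (spans_gen sU). Qed.

Lemma to_min1 x : (forall s, s \in U -> N x s = false) -> to_min x = 1.
Proof.
move=> nd; apply: invg_inj; rewrite invg1.
apply: minimal_uniq (@to_min_minimal x) _ _; first exact/spansUV/to_min_spans.
by move=> s sU; rewrite mulKg nd.
Qed.

Lemma to_minM x w : spans U w -> to_min (w * x) * w = to_min x.
Proof.
move=> wU; apply/eqP; rewrite -divg_eq1; apply/eqP.
apply: minimal_uniq (@to_min_minimal x) _ _.
  by do !apply: spansM => //; rewrite ?invgM; try apply: spansUV; exact: to_min_spans.
by move=> s sU; rewrite mulgA mulgKV -mulgA to_min_desc.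
Qed.

(* If every generator is a descent of x, so it is of the component g of x in the
   parabolic subgroup, and every element is a prefix of g. *)
Lemma longest_bound x : (forall s, s \in U -> N x s) ->
  exists n, forall g, spans U g ->
    exists2 w : seq G, {subset w <= U} & prodw w = g /\ (size w <= n)%N.
Proof.
move=> Nx; have [z zU zx] := spansUV (to_min_spans x).
have Nz s : s \in U -> N (prodw z) s.
  move=> sU; have := Nx s sU; rewrite -{1}[x](mulKg (to_min x)) NM zx.
  rewrite (minimal_N (@to_min_minimal x)) ?addbF // conjgE invgK.
  apply: spansM; last exact: spansM (spans_gen sU) (spansUV (to_min_spans x)).
  exact: to_min_spans.
pose reduced u := forall v, {subset v <= U} -> prodw v = prodw u -> (size u <= size v)%N.
have prefix u : {subset u <= U} -> reduced u ->
    exists2 v, {subset v <= U} & prodw z = prodw u * prodw v /\ (size u + size v <= size z)%N.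
  elim: u => [|s u IHu] uU ru; first by exists z; rewrite ?mul1g.
  have sU : s \in U by apply: uU; rewrite inE eqxx.
  have u_U : {subset u <= U} by move=> a au; apply: uU; rewrite inE au orbT.
  have [v pv|v vU [pz sz]] := IHu u_U.
    move=> pv'; have := ru (s :: v); rewrite /= pv' ltnS; apply=> //.
    by move=> a; rewrite inE => /predU1P[->|/pv].
  have := Nz s sU; rewrite pz NM; case Nus: (N (prodw u) s) => /=.
    have [v' v'U [pv' sv']] := exchangeU u_U Nus.
    by have := ru v' v'U pv'; rewrite leqNgt (ltn_trans sv' (ltnSn _)).
  move=> /(exchangeU vU) [v' v'U [pv' sv']]; exists v' => //; split.
    rewrite /= pv' conjgE !mulgA; congr (_ * _).
    by rewrite -(mulgA s) mulgV mulg1 SS ?US // mul1g.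
  by apply: leq_trans sz; rewrite /= addSnnS leq_add2l.
exists (size z) => g gU.
have exP : exists n, `[< exists2 w : seq G, {subset w <= U} & prodw w = g /\ size w = n >].
  by case: gU => w wU pw; exists (size w); apply/asboolP; exists w.
case: (ex_minnP exP) => n /asboolP[w wU [pw <-]] wmin; exists w => //; split=> //.
have rw : reduced w.
  by move=> v vU pv; apply: wmin; apply/asboolP; exists v; rewrite // pv.
have [v _ [_]] := prefix w wU rw; exact: leq_trans (leq_addr _ _).
Qed.

Lemma finite_parabolic x : (forall s, s \in U -> N x s) ->
  exists2 E : seq G, uniq E & forall g, g \in E <-> spans U g.
Proof.
move=> /longest_bound [n bn].
pose ball := iter n (fun B => B ++ [seq s * g | s <- U, g <- B]) [:: 1].
have ballU g : g \in ball -> spans U g.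
  rewrite /ball; elim: n {bn ball} g => /= [|k IHk] g.
    by rewrite inE => /eqP ->; apply: spans1.
  rewrite mem_cat => /orP[/IHk //|/allpairsP[[s h] /= [sU /IHk hU ->]]].
  exact: spansM (spans_gen sU) hU.
have memball (w : seq G) : {subset w <= U} -> (size w <= n)%N -> prodw w \in ball.
  rewrite /ball; elim: n w {bn ballU ball} => [|k IHk] [|s w] wU //= wk.
  - by rewrite inE.
  - by rewrite mem_cat (IHk [::]).
  rewrite mem_cat; apply/orP; right; apply/allpairsP; exists (s, prodw w); split=> //=.
    by apply: wU; rewrite inE eqxx.
  by apply: IHk => // a aw; apply: wU; rewrite inE aw orbT.
exists (undup ball); first exact: undup_uniq.
move=> g; rewrite mem_undup; split=> [/ballU //|/bn [w wU [<- sw]]].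
exact: memball.
Qed.

End Parabolic.

Local Close Scope group_scope.

(** Sequences are treated as chambers through their first entry, which is equivariant on nonempty
    ones. The default 1 has no descents by [N1], and [lmul] fixes the empty sequence. *)
Let slen (x : seq G) := len (head 1%g x).
Let sdesc (s : G) (x : seq G) := N (head 1%g x) s.
Let snf (U : seq G) (x : seq G) := lmul (to_min U (head 1%g x)) x.

Lemma acyclic_no_longest (T : seq G) : {subset T <= S} ->
  (forall g, exists2 s, s \in T & ~~ N g s) ->
  (forall U, {subset U <= T} -> (size U < size T)%N -> acyclic U) -> acyclic T.
Proof.
move=> TS nl col; have [a aT _] := nl 1%g.
apply: (@acyclic_rows _ _ _ col a aT) => F.
have TS' (U : seq G) : {subset U <= T} -> {subset U <= S} by move=> UT s /UT/TS.
apply: (@row_exact _ _ T (@lmul G) slen sdesc snf).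
- move=> s [|y x] sT; rewrite /sdesc /slen /=; first by rewrite N1.
  exact: len_exchange.
- move=> U s [|y x] UT sU //; rewrite /snf lmulM /=.
  by rewrite (to_minM (TS' _ UT) _ (spans_gen sU)).
- move=> U x UT nd; rewrite /snf (to_min1 (TS' _ UT)) ?lmul1 // => s sU.
  exact/negbTE/nd.
- move=> U s [|y x] UT sU; rewrite /sdesc /snf /=; first by rewrite N1.
  by rewrite to_min_desc //; apply: TS'.
- by move=> U f x UT fU; apply: invariant_spans fU _; apply: to_min_spans.
- move=> U [|y x] UT; rewrite /slen /snf //=.
  have := @to_min_minimal U y (to_min U y)^-1%g; rewrite mulKg; apply.
  exact: spansUV (TS' _ UT) _ (to_min_spans U y).
- by move=> x; apply: nl.
Qed.

Lemma acyclic_finite (T : seq G) g : {subset T <= S} -> (forall s, s \in T -> N g s) ->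
  acyclic T.
Proof.
move=> TS gT; have [E uE EP] := finite_parabolic TS gT.
apply: (acyclic_average uE).
- by have /EP := spans1 T; case: (E).
- move=> e /EP eT s sT; apply/EP; exact: spansM eT (spans_gen sT).
- by move=> e /EP.
Qed.

(** The finite case is recognized by some [g] having all of [T] as descents; [g] may be taken in the
    whole group. *)
Theorem acyclic_reflections (T : seq G) : {subset T <= S} -> acyclic T.
Proof.
have [n] := ubnP (size T); elim: n T => // n IHn T Tn TS.
case: (pselect (exists g, forall s, s \in T -> N g s)) => [[g]|nex].
  exact: acyclic_finite.
apply: acyclic_no_longest => // [g|U UT sU].
  apply: contrapT => nx; apply: nex; exists g => s sT.
  by apply/negPn/negP => gs; apply: nx; exists s.
by apply: IHn; [exact: leq_trans sU Tn|move=> s /UT/TS].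
Qed.

End Reflections.

(** * The reflection cocycle of the flat braid group *)

Lemma invg_sqr1 (G : groupType) (a : G) : (a * a = 1 -> a^-1 = a)%g.
Proof. by move=> a2; rewrite -[LHS]mulg1 -a2 mulKg. Qed.

Section SignExtension.
Variable G : groupType.
Local Open Scope group_scope.

(* F_2^G x| G, with G acting by conjugation on the index set. *)
Definition signext : Type := ((G -> bool) * G)%type.

HB.instance Definition _ := Choice.on signext.

Definition signext_mul (p q : signext) : signext :=
  (fun x => p.1 x (+) q.1 (x ^ p.2), p.2 * q.2).
Definition signext_one : signext := (fun=> false, 1).
Definition signext_inv (p : signext) : signext := (fun x => p.1 (x ^ p.2^-1), p.2^-1).

Lemma signext_mulA : associative signext_mul.
Proof.
move=> p q r; congr (_, _); rewrite /= ?mulgA //.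
by apply/funext => x; rewrite addbA conjgM.
Qed.

Lemma signext_mul1 : left_id signext_one signext_mul.
Proof.
by case=> A g; congr (_, _); rewrite /= ?mul1g //; apply/funext => x; rewrite conjg1.
Qed.

Lemma signext_1mul : right_id signext_one signext_mul.
Proof.
by case=> A g; congr (_, _); rewrite /= ?mulg1 //; apply/funext => x; rewrite addbF.
Qed.

Lemma signext_mulV : left_inverse signext_one signext_inv signext_mul.
Proof.
by case=> A g; congr (_, _); rewrite /= ?mulVg //; apply/funext => x; rewrite addbb.
Qed.

Lemma signext_Vmul : right_inverse signext_one signext_inv signext_mul.
Proof.
case=> A g; congr (_, _); rewrite /= ?mulgV //; apply/funext => x.
by rewrite conjgK addbb.
Qed.

HB.instance Definition _ := isGroup.Build signext
  signext_mulA signext_mul1 signext_1mul signext_mulV signext_Vmul.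

Definition refl (a : G) : signext := (fun x => x == a, a).
Definition unsigned (g : G) : signext := (fun=> false, g).

Lemma conj_eq (x g y : G) : (x ^ g == y) = (x == y ^ g^-1).
Proof. by rewrite -(inj_eq (@conjg_inj _ g)) conjgKV. Qed.

Lemma refl_sqr a : a * a = 1 -> refl a * refl a = 1.
Proof.
move=> a2; congr (_, _); rewrite //; apply/funext => x /=.
by rewrite conj_eq conjgE invgK mulgV mulg1 addbb.
Qed.

Lemma unsigned_sqr a : a * a = 1 -> unsigned a * unsigned a = 1.
Proof. by move=> a2; congr (_, _). Qed.

Lemma refl_comm a b : a * b = b * a -> refl a * refl b = refl b * refl a.
Proof.
move=> ab; congr (_, _); rewrite //; apply/funext => x /=.
by rewrite !conj_eq !conjgE !invgK !mulgA ab mulgK -ab mulgK addbC.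
Qed.

Lemma refl_unsigned_comm a b :
  a * b = b * a -> unsigned a * refl b = refl b * unsigned a.
Proof.
move=> ab; congr (_, _); rewrite //; apply/funext => x /=.
by rewrite !conj_eq !conjgE !invgK !mulgA ab mulgK addbF.
Qed.

(** On both sides the marked elements are [a], [b] and [a * b * a]. *)
Lemma refl_braid a b : a * a = 1 -> b * b = 1 -> a * (b * a) = b * (a * b) ->
  refl a * (refl b * refl a) = refl b * (refl a * refl b).
Proof.
move=> a2 b2 ab; congr (_, _); rewrite //; apply/funext => x /=.
have aV := invg_sqr1 a2.
have bV := invg_sqr1 b2.
have aba : (a ^ b) ^ a = b.
  by rewrite !conjgE aV bV -ab -!mulgA a2 mulg1 mulgA a2 mul1g.
have bab : (b ^ a) ^ b = a.
  by rewrite !conjgE aV bV ab -!mulgA b2 mulg1 mulgA b2 mul1g.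
rewrite !conj_eq aV bV aba bab !conjgE aV bV ab.
by case: (x == a); case: (x == b); case: (x == _).
Qed.

Lemma refl_mixed a b u v : u * u = 1 -> v * v = 1 -> u * (b * u) = v * (a * v) ->
  unsigned u * (refl b * unsigned u) = unsigned v * (refl a * unsigned v).
Proof.
move=> u2 v2 uv; congr (_, _); rewrite //; apply/funext => x /=.
have uV := invg_sqr1 u2.
have vV := invg_sqr1 v2.
by rewrite !conj_eq !conjgE !invgK uV vV uv.
Qed.

End SignExtension.

Section FlatBraid.
Variable n : nat.
Local Open Scope group_scope.

Definition gen (x : vgen n) : fB n := pres_class (@fB_rel n) [:: (x, false)].

Lemma genV x : (gen x)^-1 = pres_class (@fB_rel n) [:: (x, true)].
Proof.
apply: (mulgI (gen x)); rewrite mulgV; apply/esym.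
rewrite [LHS](pres_mulE _ [:: (x, false)] [:: (x, true)]).
exact/pres_classP/weq_cancel.
Qed.

Lemma weval_gen w : weval gen w = pres_class (@fB_rel n) w.
Proof.
elim: w => //= -[x b] w ->; rewrite /leval /=.
have -> : (if b then (gen x)^-1 else gen x) = pres_class (@fB_rel n) [:: (x, b)].
  by case: b; rewrite ?genV.
exact: pres_mulE.
Qed.

Lemma gen_rel u v : fB_rel u v -> weval gen u = weval gen v.
Proof. by move=> uv; rewrite !weval_gen; apply/pres_classP/weq_rel. Qed.

Definition sig (i : 'I_n.-1) : fB n := gen (inl i).
Definition vir (i : 'I_n.-1) : fB n := gen (inr i).

Lemma sig_sqr (i : 'I_n.-1) : sig i * sig i = 1.
Proof. by have := gen_rel (fB_sg_sqr i); rewrite /= /leval /= mulg1. Qed.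

Lemma sigV (i : 'I_n.-1) : (sig i)^-1 = sig i.
Proof. exact/invg_sqr1/sig_sqr. Qed.

Lemma vir_sqr (i : 'I_n.-1) : vir i * vir i = 1.
Proof. by have := gen_rel (fB_vB (vB_sv_sqr i)); rewrite /= /leval /= mulg1. Qed.

Lemma virV (i : 'I_n.-1) : (vir i)^-1 = vir i.
Proof. exact/invg_sqr1/vir_sqr. Qed.

Lemma sig_braid (i j : 'I_n.-1) : j = i.+1 :> nat ->
  sig i * (sig j * sig i) = sig j * (sig i * sig j).
Proof.
by move=> /vB_sg_braid/fB_vB/gen_rel; rewrite /= /leval /= !mulg1.
Qed.

Lemma sig_far (i j : 'I_n.-1) : far i j -> sig i * sig j = sig j * sig i.
Proof. by move=> /vB_sg_far/fB_vB/gen_rel; rewrite /= /leval /= !mulg1. Qed.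

Lemma vir_braid (i j : 'I_n.-1) : j = i.+1 :> nat ->
  vir i * (vir j * vir i) = vir j * (vir i * vir j).
Proof. by move=> /vB_sv_braid/fB_vB/gen_rel; rewrite /= /leval /= !mulg1. Qed.

Lemma vir_far (i j : 'I_n.-1) : far i j -> vir i * vir j = vir j * vir i.
Proof. by move=> /vB_sv_far/fB_vB/gen_rel; rewrite /= /leval /= !mulg1. Qed.

Lemma mixed (i j : 'I_n.-1) : j = i.+1 :> nat ->
  vir i * (sig j * vir i) = vir j * (sig i * vir j).
Proof. by move=> /vB_mixed/fB_vB/gen_rel; rewrite /= /leval /= !mulg1. Qed.

Lemma mixed_far (i j : 'I_n.-1) : far i j -> vir i * sig j = sig j * vir i.
Proof. by move=> /vB_mixed_far/fB_vB/gen_rel; rewrite /= /leval /= !mulg1. Qed.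

Definition sgen (x : vgen n) : signext (fB n) :=
  match x with inl i => refl (sig i) | inr i => unsigned (vir i) end.

Lemma sgenV x : (sgen x)^-1 = sgen x.
Proof.
apply: invg_sqr1.
by case: x => i; [apply: refl_sqr (sig_sqr i)|apply: unsigned_sqr (vir_sqr i)].
Qed.

Lemma sgen_rel u v : fB_rel u v -> weval sgen u = weval sgen v.
Proof.
case=> {u v} [_ _ []|i]; rewrite /= /leval /= ?mulg1.
- by move=> i j /sig_braid ij; rewrite !mulg1; apply: refl_braid; rewrite ?sig_sqr.
- by move=> i j /sig_far ij; rewrite !mulg1; apply: refl_comm.
- by move=> i j /vir_braid ij; rewrite !mulg1; congr (_, _).
- by move=> i j /vir_far ij; rewrite !mulg1; congr (_, _).
- by move=> i; rewrite mulg1; apply/unsigned_sqr/vir_sqr.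
- by move=> i j /mixed ij; rewrite !mulg1; apply: refl_mixed; rewrite ?vir_sqr.
(* The images of the generators are involutions, which reduces the relation with inverses to the
   positive one. *)
- move=> i j /mixed ij; rewrite !mulg1 -[refl (sig i)]/(sgen (inl i)).
  rewrite -[refl (sig j)]/(sgen (inl j)) !sgenV.
  by apply: refl_mixed; rewrite ?vir_sqr.
- by move=> i j /mixed_far ij; rewrite !mulg1; apply: refl_unsigned_comm.
- exact/refl_sqr/sig_sqr.
Qed.

Definition refl_cocycle (g : fB n) : fB n -> bool := (pres_hom sgen g).1.

(** The homomorphism is thus a section of the projection from the extension, so its first component
    is a cocycle. *)
Lemma pres_hom_sgen2 g : (pres_hom sgen g).2 = g.
Proof.
rewrite -{2}(pres_reprK g) /pres_hom -weval_gen.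
elim: (generic_quotient.repr g) => //= -[[i|i] b] w IHw; rewrite /leval /=;
  by case: b; rewrite /= IHw.
Qed.

Lemma refl_cocycleM g h x :
  refl_cocycle (g * h) x = refl_cocycle g x (+) refl_cocycle h (x ^ g).
Proof.
by rewrite /refl_cocycle (pres_homM sgen_rel) /= pres_hom_sgen2.
Qed.

Lemma refl_cocycle_sig i x : refl_cocycle (sig i) x = (x == sig i).
Proof. by rewrite /refl_cocycle (pres_homE sgen_rel) /= addbF. Qed.

Lemma refl_cocycle_vir i x : refl_cocycle (vir i) x = false.
Proof. by rewrite /refl_cocycle (pres_homE sgen_rel). Qed.

End FlatBraid.

(** * Finiteness of the subgroup generated by the s_i *)

Section TypeA.
Variables (G : groupType) (m : nat) (a : nat -> G).
Local Open Scope group_scope.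

Hypothesis a_sqr : forall i, (i < m)%N -> a i * a i = 1.
Hypothesis a_braid : forall i, (i.+1 < m)%N ->
  a i * (a i.+1 * a i) = a i.+1 * (a i * a i.+1).
Hypothesis a_far : forall i j, (i < m)%N -> (j < m)%N -> (i.+1 < j)%N || (j.+1 < i)%N ->
  a i * a j = a j * a i.

(* a_k a_{k-1} ... with d factors: the coset representatives of S_{k+1} in S_{k+2}. *)
Fixpoint run (k d : nat) : G := if d is d'.+1 then run k d' * a (k - d')%N else 1.

Lemma run_comm k d l : (d <= k.+1)%N ->
  (forall i, (i <= k)%N -> (k < i + d)%N -> a i * a l = a l * a i) ->
  run k d * a l = a l * run k d.
Proof.
elim: d => [|d IHd] dk al /=; first by rewrite mul1g mulg1.
rewrite -mulgA al; [|lia|lia].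
rewrite mulgA IHd ?mulgA //; first by lia.
by move=> i ik kid; apply: al => //; lia.
Qed.

(** Moving left, [a j] commutes with the low factors until it meets [a j * a j.-1]; the braid
    relation turns it into [a j.-1], which commutes with the remaining high factors. *)
Lemma run_braid k j d : (k < m)%N -> (j <= k)%N -> (d <= k.+1)%N -> (k.+1 < j + d)%N ->
  run k d * a j = a j.-1 * run k d.
Proof.
move=> km jk; elim: d => [|d IHd] dk kjd; first by lia.
have [e|kjd'] := eqVneq (j + d)%N k.+1; last first.
  rewrite /= -mulgA a_far; [|lia|lia|lia].
  by rewrite mulgA IHd ?mulgA //; lia.
case: d {IHd} dk e kjd => [|d] dk e kjd; first by lia.
have -> : run k d.+2 = run k d * (a j * a j.-1).
  by rewrite /= -mulgA; congr (_ * (a _ * a _)); lia.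
have jE : j = j.-1.+1 by lia.
have br : a j * a j.-1 * a j = a j.-1 * (a j * a j.-1).
  by have := @a_braid j.-1; rewrite -jE => ->; rewrite ?mulgA //; lia.
rewrite -mulgA br !mulgA; congr (_ * _ * _); apply: run_comm; first by lia.
by move=> i ik kid; apply: a_far; lia.
Qed.

Fixpoint typeA (k : nat) : seq G :=
  if k is k'.+1 then [seq e * run k' d | e <- typeA k', d <- iota 0 k'.+2] else [:: 1].

Lemma typeA1 k : 1 \in typeA k.
Proof.
elim: k => [|k IHk]; first by rewrite inE.
by apply/allpairsP; exists (1, 0%N); split; rewrite //= mulg1.
Qed.

(** Write the last run as [run k d], for the predecessor [k]. Then [a j] commutes past it if
    [j + d < k], lengthens it if [j + d = k], cancels its last factor if [j + d = k + 1], and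
    otherwise passes through as [a j.-1]. *)
Lemma typeA_mul k e j : (k <= m)%N -> (j < k)%N -> e \in typeA k -> e * a j \in typeA k.
Proof.
elim: k e j => // k IHk e0 j km jk /allpairsP[[e d] [ek]].
rewrite mem_iota add0n [_.1]/= [_.2]/= => /andP[_ dk] ->; rewrite /= in ek.
have mem e' d' : e' \in typeA k -> (d' <= k.+1)%N -> e' * run k d' \in typeA k.+1.
  by move=> e'k d'k; apply/allpairsP; exists (e', d'); split; rewrite ?mem_iota.
rewrite -mulgA; case: (ltngtP (j + d)%N k) => jdk.
- rewrite run_comm; [|lia|by move=> i ik kid; apply: a_far; lia].
  by rewrite mulgA; apply: mem; [apply: IHk => //; lia|lia].
- case: (ltngtP (j + d)%N k.+1) => jdk'; first by lia.
    rewrite run_braid //.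
    by rewrite mulgA; apply: mem; [apply: IHk => //; lia|lia].
  case: d jdk jdk' dk => [|d] jdk jdk' dk; first by lia.
  have -> : run k d.+1 * a j = run k d.
    by rewrite /= -mulgA (_ : k - d = j)%N ?a_sqr ?mulg1 //; lia.
  by apply: mem => //; lia.
have -> : run k d * a j = run k d.+1 by rewrite /= (_ : k - d = j)%N //; lia.
by apply: mem => //; lia.
Qed.

Lemma typeA_ind (P : G -> Prop) : P 1 -> (forall g i, (i < m)%N -> P g -> P (g * a i)) ->
  forall k e, (k <= m)%N -> e \in typeA k -> P e.
Proof.
move=> P1 Pa; elim=> [|k IHk] e0 km; first by rewrite inE => /eqP ->.
move=> /allpairsP[[e d] /= [ek _ ->]]; elim: d => [|d IHd].
  by rewrite mulg1; apply: IHk ek; lia.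
by rewrite /= mulgA; apply: Pa => //; lia.
Qed.

End TypeA.

(** * Rational acyclicity of the flat braid group *)

Section FlatBraidAcyclic.
Variable n : nat.
Local Open Scope group_scope.

Definition vir_nat (j : nat) : fB n := if insub j is Some i then vir i else 1.

Lemma vir_natE (i : 'I_n.-1) : vir_nat i = vir i.
Proof. by rewrite /vir_nat valK. Qed.

Definition virs : seq (fB n) := undup (typeA vir_nat n.-1).

Lemma virs1 : 1 \in virs.
Proof. by rewrite mem_undup typeA1. Qed.

Lemma virs_mul e i : e \in virs -> e * vir i \in virs.
Proof.
rewrite !mem_undup -vir_natE.
apply: (@typeA_mul _ n.-1); rewrite // => j.
- by move=> jn; rewrite (vir_natE (Ordinal jn)) vir_sqr.
- move=> jn; rewrite (vir_natE (Ordinal jn)) (vir_natE (Ordinal (ltnW jn))).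
  exact: vir_braid.
move=> l jn ln far; rewrite (vir_natE (Ordinal jn)) (vir_natE (Ordinal ln)).
exact: vir_far.
Qed.

Lemma refl_cocycle1 x : refl_cocycle (1 : fB n) x = false.
Proof. exact: (N1 (@refl_cocycleM n)). Qed.

Lemma refl_cocycle_virs e x : e \in virs -> refl_cocycle e x = false.
Proof.
rewrite mem_undup => ev.
apply: (@typeA_ind _ n.-1 vir_nat (fun g => forall x, refl_cocycle g x = false)
  _ _ _ _ _ ev) => //.
- exact: refl_cocycle1.
- move=> g i im g0 y.
  by rewrite refl_cocycleM g0 (vir_natE (Ordinal im)) refl_cocycle_vir.
Qed.

Definition refls : seq (fB n) := [seq sig i ^ e^-1 | e <- virs, i <- enum 'I_n.-1].

Lemma refls_mem e i : e \in virs -> sig i ^ e^-1 \in refls.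
Proof. by move=> ev; apply/allpairsP; exists (e, i); rewrite mem_enum. Qed.

(** The cocycle vanishes on [virs] and on inverses of its elements, so conjugation just transports
    the indicator of [sig i]. *)
Lemma refl_cocycle_refls s x : s \in refls -> refl_cocycle s x = (x == s).
Proof.
move=> /allpairsP[[e i] /= [ev _ ->]].
have eV y : refl_cocycle e^-1 y = false.
  have := refl_cocycleM e e^-1 (y ^ e^-1).
  by rewrite mulgV refl_cocycle1 refl_cocycle_virs // conjgKV => /esym.
rewrite conjgE invgK !refl_cocycleM eV refl_cocycle_virs //.
by rewrite refl_cocycle_sig addbF conj_eq conjgE invgK.
Qed.

Lemma refls_sqr s : s \in refls -> s * s = 1.
Proof. by move=> /allpairsP[[e i] /= [_ _ ->]]; rewrite -conjMg sig_sqr conj1g. Qed.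

Definition gens : seq (fB n) := [seq gen (inl i) | i <- enum 'I_n.-1] ++
  [seq gen (inr i) | i <- enum 'I_n.-1].

Lemma gen_gens x : gen x \in gens.
Proof.
by rewrite mem_cat; case: x => i; apply/orP; [left|right];
  apply/mapP; exists i; rewrite ?mem_enum.
Qed.

Lemma spans_gens g : spans gens g.
Proof.
exists [seq gen l.1 | l <- generic_quotient.repr g].
  by move=> _ /mapP[l _ ->]; apply: gen_gens.
rewrite -[RHS]pres_reprK -weval_gen; elim: (generic_quotient.repr g) => //= -[x b] w ->.
by congr (_ * _); rewrite /leval /=; case: b x => [] [] i //; rewrite ?[RHS]sigV ?[RHS]virV.
Qed.

Lemma acyclic_refls : acyclic refls.
Proof.
apply: (@acyclic_reflections _ (@refl_cocycle n) refls) => //.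
- exact: refl_cocycleM.
- by move=> s x; apply: refl_cocycle_refls.
- exact: refls_sqr.
move=> g; have [w wg pw] := spans_gens g; exists w => // a /wg; rewrite mem_cat.
case/orP => /mapP[i _ ->]; [left|right].
  by rewrite -[gen _]conjg1 -invg1 refls_mem ?virs1.
exact: refl_cocycle_vir.
Qed.

Lemma acyclic_gens : acyclic gens.
Proof.
move=> f fg df; have fG g x : f (lmul g x) = f x := invariant_spans x fg (spans_gens g).
have [|h hr dh] := acyclic_refls _ df; first by move=> s _ x.
have v0 : (0 < size virs)%N by have := virs1; case: virs.
exists (average virs h); last first.
  move=> x; rewrite average_sdiff -[RHS](average_const v0) //.
  by congr (_ * _)%R; apply: eq_bigr => e _; apply: dh.
move=> s; rewrite mem_cat => /orP[] /mapP[i _ ->] x.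
  (* For [sig i] the summands agree one by one: moving [sig i] to the left of [e] conjugates it into
     an element of [refls], under which [h] is invariant. *)
  congr (_ * _)%R; apply: eq_big_seq => e ev.
  by rewrite lmulM -[RHS](hr _ (refls_mem i ev)) lmulM conjgE invgK -!mulgA mulVg mulg1.
apply: average_inv; first exact: undup_uniq.
by move=> e ev; apply: virs_mul.
Qed.

End FlatBraidAcyclic.

(** * Homogeneous cochains as functions on sequences *)

Section Cochains.
Variable G : groupType.

Definition list_of (k : nat) (x : 'I_k -> G) : seq G := [seq x j | j <- enum 'I_k].

Lemma size_list_of k (x : 'I_k -> G) : size (list_of x) = k.
Proof. by rewrite size_map size_enum_ord. Qed.

Lemma nth_list_of k (x : 'I_k -> G) (j : 'I_k) : nth 1%g (list_of x) j = x j.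
Proof. by rewrite (nth_map j) ?size_enum_ord // nth_ord_enum. Qed.

Lemma list_of_nth k u : size u = k -> list_of (fun j : 'I_k => nth 1%g u j) = u.
Proof.
move=> uk; apply: (@eq_from_nth _ 1%g); rewrite size_list_of // => i ik.
by rewrite (nth_list_of _ (Ordinal ik)).
Qed.

Lemma list_of_face k (x : 'I_k.+1 -> G) (i : 'I_k.+1) :
  take i (list_of x) ++ drop i.+1 (list_of x) = list_of (fun j => x (lift i j)).
Proof.
have ik : (i < size (list_of x))%N by rewrite size_list_of.
apply: (@eq_from_nth _ 1%g).
  by rewrite size_cat (size_takel (ltnW ik)) size_drop !size_list_of; have := ltn_ord i; lia.
rewrite size_cat (size_takel (ltnW ik)) size_drop size_list_of => j jk.
have jk' : (j < k)%N by have := ltn_ord i; lia.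
rewrite (nth_list_of _ (Ordinal jk')) -nth_list_of nth_cat (size_takel (ltnW ik)).
rewrite [RHS]/= /bump; case: (ltnP j i) => ij; first by rewrite nth_take.
by rewrite nth_drop; congr (nth _ _ _); lia.
Qed.

Lemma cobound_list k (h : seq G -> rat) (x : 'I_k.+2 -> G) :
  cobound (fun y : 'I_k.+1 -> G => h (list_of y)) x = sdiff h (list_of x).
Proof.
rewrite sdiffE size_list_of big_mkord; apply: eq_bigr => i _.
by rewrite list_of_face.
Qed.

(** [acyclic] treats all degrees at once, so the cochain is extended by 0 to the other lengths. *)
Definition seq_cochain k (f : cochain G k) (u : seq G) : rat :=
  if size u == k.+1 then f (fun j => nth 1%g u j) else 0.

Lemma seq_cochain_list k (f : cochain G k) x : seq_cochain f (list_of x) = f x.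
Proof.
by rewrite /seq_cochain size_list_of eqxx; congr f; apply/funext => j; apply: nth_list_of.
Qed.

Lemma sdiff_seq_cochain k (f : cochain G k) u : cobound f = 0 ->
  sdiff (seq_cochain f) u = 0.
Proof.
move=> df; have [uk|uk] := eqVneq (size u) k.+2; last first.
  rewrite -[RHS](sdiff0 u); apply: eq_sdiff => v _ vu.
  by rewrite /seq_cochain -eqSS vu (negPf uk).
rewrite -(list_of_nth uk) -cobound_list.
rewrite (_ : (fun y => _) = f) ?df //; apply/funext => y; exact: seq_cochain_list.
Qed.

Lemma acyclic_cobound (U : seq G) k (f : cochain G k.+1) :
  acyclic U -> (forall g, spans U g) -> is_cocycle f -> is_coboundary f.
Proof.
move=> aU sU [fi fc].
have [|h hi dh] := aU (seq_cochain f) _ (fun u => sdiff_seq_cochain u fc).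
  move=> s _ u; rewrite /seq_cochain size_map; case: eqP => // uk.
  rewrite -[RHS](fi s); congr f; apply/funext => j.
  by rewrite (nth_map 1%g) // uk.
exists (fun y => h (list_of y)).
  move=> g y; rewrite -[RHS](invariant_spans (list_of y) hi (sU g)).
  by rewrite /lmul /list_of -[in RHS]map_comp.
by apply/funext => y; rewrite cobound_list dh seq_cochain_list.
Qed.

End Cochains.

Lemma coh_class0 (G : groupType) k : coh_class (0 : cocycle G k) = 0.
Proof. by rewrite -[in LHS](scale0r 0) coh_classZ scale0r. Qed.

Lemma cohomology_fB0 n k (c : cohomology (fB n) k.+1) : c = 0.
Proof.
rewrite -(coh_reprK c) -coh_class0; apply/coh_classP.
rewrite subr0; case: (coh_repr c) => f /asboolP fc /=.
exact: acyclic_cobound (@acyclic_gens n) (@spans_gens n) fc.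
Qed.

(** * Transfer *)

Section Transfer.
Variable n : nat.

(** These permutations index the cosets of the pure group in [fB n]. *)
Definition in_image (s : 'S_n) : bool := `[< exists g : fB n, fB_perm g = s >].

Lemma fB_permV (g : fB n) : fB_perm g^-1%g = (fB_perm g)^-1%g.
Proof. by apply: (mulgI (fB_perm g)); rewrite -fB_permM !mulgV fB_perm1. Qed.

Lemma in_imageM (s : 'S_n) (g : fB n) : in_image (s * fB_perm g)%g = in_image s.
Proof.
apply/asboolP/asboolP => -[h hs].
  by exists (h * g^-1)%g; rewrite fB_permM hs fB_permV mulgK.
by exists (h * g)%g; rewrite fB_permM hs.
Qed.

Lemma section_exists : exists t : 'S_n -> fB n, forall s, in_image s -> fB_perm (t s) = s.
Proof.
suff /choice[t tP] : forall s, exists g : fB n, in_image s -> fB_perm g = s by exists t.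
move=> s; case: (boolP (in_image s)) => [/asboolP[g gs]|]; first by exists g.
by exists 1%g.
Qed.

Definition sect : 'S_n -> fB n := projT1 (cid section_exists).

Lemma sectK s : in_image s -> fB_perm (sect s) = s.
Proof. exact: (projT2 (cid section_exists)). Qed.

Lemma sectE g : fB_perm (sect (fB_perm g)) = fB_perm g.
Proof. by apply: sectK; apply/asboolP; exists g. Qed.

Lemma retract_subproof (g : fB n) : (g * (sect (fB_perm g))^-1)%g \in @PfB_pred n.
Proof. by rewrite inE fB_permM fB_permV sectE mulgV. Qed.

Definition retract (g : fB n) : PfB n :=
  Sub (g * (sect (fB_perm g))^-1)%g (retract_subproof g).

Lemma retractM (p : PfB n) g : retract (val p * g)%g = (p * retract g)%g.
Proof.
apply: val_inj; rewrite gmulfM !SubK fB_permM.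
by have /eqP -> := valP p; rewrite mul1g mulgA.
Qed.

Lemma retract_split g : (val (retract g) * sect (fB_perm g))%g = g.
Proof. by rewrite SubK mulgVK. Qed.

Lemma retract_conj s (p : PfB n) : in_image s ->
  retract (sect s * val p)%g = PfB_conj (sect s)^-1%g p.
Proof.
move=> sP; apply: val_inj; rewrite !SubK fB_permM sectK //.
by have /eqP -> := valP p; rewrite mulg1 conjgE invgK mulgA.
Qed.

Definition transfer k (f : cochain (PfB n) k) : cochain (fB n) k :=
  fun x => \sum_(s | in_image s) f (fun j => retract (sect s * x j)%g).

(** Right multiplication by [g] permutes the cosets, and each representative changes by a pure
    factor that [f] absorbs. *)
Lemma transfer_ginvariant k (f : cochain (PfB n) k) :
  ginvariant f -> ginvariant (transfer f).
Proof.
move=> fi g x; rewrite /transfer [RHS](reindex_inj (mulIg (fB_perm g))).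
apply: eq_big => [s|s sP]; first by rewrite in_imageM.
rewrite -[RHS](fi (retract (sect s * g)%g)); congr f; apply/funext => j.
rewrite -retractM; congr retract.
have {1}-> : (s * fB_perm g)%g = fB_perm (sect s * g)%g by rewrite fB_permM sectK.
by rewrite [RHS]mulgA retract_split mulgA.
Qed.

Lemma transfer_cobound k (f : cochain (PfB n) k) : cobound f = 0 -> cobound (transfer f) = 0.
Proof.
move=> df; apply/funext => x.
transitivity (\sum_(s | in_image s) cobound f (fun j => retract (sect s * x j)%g)).
  rewrite /cobound /transfer exchange_big; apply: eq_bigr => i _.
  by rewrite mulr_sumr.
by rewrite df big1.
Qed.

Lemma coh_class_sum (G : groupType) k (J : Type) (r : seq J) (Q : pred J)
    (z : J -> cocycle G k) :
  coh_class (\sum_(j <- r | Q j) z j) = \sum_(j <- r | Q j) coh_class (z j).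
Proof.
exact: (big_morph _ (@coh_classD G k) (coh_class0 G k)).
Qed.

(** Restricted back to [PfB n], the transfer of [z] is the sum of its conjugates, of class a
    positive multiple of [c]. The transfer is a coboundary over [fB n], so this multiple is 0. *)
Lemma Sn_invariant0 k (c : cohomology (PfB n) k.+1) : c \in @Sn_invariant n k.+1 -> c = 0.
Proof.
move=> /asboolP ci; pose z := coh_repr c.
have /asboolP[zi zc] := valP z.
have tc : transfer (val z) \in @cocycle_pred (fB n) k.+1.
  by apply/asboolP; split; [apply: transfer_ginvariant|apply: transfer_cobound].
have := cohomology_fB0 (coh_class (Sub (transfer (val z)) tc : cocycle _ _)).
rewrite -coh_class0 => /coh_classP; rewrite subr0 SubK.
move=> /(@pull_coboundary _ _ (val : PfB n -> fB n)) bt.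
pose w := \sum_(s | in_image s) pull_cocycle (PfB_conj (sect s)^-1%g) z.
have w0 : coh_class w = 0.
  rewrite -coh_class0; apply/coh_classP; rewrite subr0; congr is_coboundary: bt.
  rewrite raddf_sum; apply/funext => x; rewrite fct_sumE.
  apply: eq_bigr => s sP; rewrite -[RHS]/(pull (PfB_conj (sect s)^-1%g) (val z) x).
  congr (val z _).
  by apply/funext => j; apply: retract_conj.
move: w0; rewrite coh_class_sum (eq_bigr (fun=> c)) => [|s _].
  rewrite big_const iter_addr_0 -scaler_nat => /eqP.
  rewrite scaler_eq0 pnatr_eq0 => /orP[|/eqP //].
  rewrite eqn0Ngt => /negP[]; apply/card_gt0P; exists 1%g; apply/asboolP.
  by exists 1%g; apply: fB_perm1.
by rewrite -coh_pullE coh_reprK; apply: ci (erefl _).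
Qed.

End Transfer.

Lemma lmod_iso_trivial (R : pzRingType) (U V : lmodType R) :
  (forall u : U, u = 0) -> (forall v : V, v = 0) -> lmod_iso U V.
Proof.
move=> U0 V0; exists (\0 : {linear U -> V}); exists (fun=> 0) => x.
  by rewrite [x]U0.
by rewrite [RHS]V0.
Qed.

Local Close Scope ring_scope.

(* 'rV[rat]_0 is the zero vector space. *)
Theorem theorem14 :
  (forall n k : nat, 1 <= n -> 1 <= k ->
     lmod_iso (cohomology (fB n) k) 'rV[rat]_0) /\
  (forall n k : nat, 1 <= k -> k < n ->
     lmod_iso (Sn_invariants n k) (cohomology (fB n) k) /\
     lmod_iso (cohomology (fB n) k) 'rV[rat]_0).
Proof.
have iso0 n k : 1 <= k -> lmod_iso (cohomology (fB n) k) 'rV[rat]_0.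
  case: k => // k _; apply: lmod_iso_trivial => [|v]; first exact: cohomology_fB0.
  exact: thinmx0.
split=> [n k _|n k k0 _]; first exact: iso0.
split; last exact: iso0.
case: k k0 => // k _; apply: lmod_iso_trivial; last exact: cohomology_fB0.
by move=> c; apply: val_inj; apply: Sn_invariant0 (valP c).
Qed.
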